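(* Let $\nu$ and $c$ be fixed (known) real numbers with $\nu>1$ and $0<c<\sqrt{\nu}$, and consider the robust heavy-tailed gamma generalized linear model with density $f_{\nu,c}$ and the data indexed by $\omega$ described in the context. Suppose that under the prior $\pi$ the components of $\boldsymbol\beta=(\beta_1,\dots,\beta_p)^T$ are independent and each $\beta_j$ has a sub-exponential distribution. Then, as $\omega\to\infty$: (a) $m_\omega(\mathbf{y})\big/\prod_{i\in\mathrm{O}}f_{\nu,c}(y_i)\to m(\mathbf{y}_{\mathrm{O}^{\mathsf c}})$; (b) for every $\boldsymbol\beta\in\mathbb{R}^p$, $\pi_\omega(\boldsymbol\beta\mid\mathbf{y})\to\pi(\boldsymbol\beta\mid\mathbf{y}_{\mathrm{O}^{\mathsf c}})$; (c) the posterior distribution $\pi_\omega(\cdot\mid\mathbf{y})$ converges in distribution to $\pi(\cdot\mid\mathbf{y}_{\mathrm{O}^{\mathsf c}})$.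
   Context: Density $f_{\nu,c}$ (for $\nu>1$, $0<c<\sqrt\nu$). Let $f_{\mathrm{mid}}(z)=e^{-\nu z}z^{\nu-1}\nu^\nu/\Gamma(\nu)$, $z_{\mathrm r}=1+c/\sqrt\nu$, $z_{\mathrm l}=1-c/\sqrt\nu\in(0,1)$, let $Z_\nu$ be a gamma random variable with mean $1$ and shape $\nu$ (density $f_{\mathrm{mid}}$ on $(0,\infty)$), and $$\lambda_{\mathrm r}=1+\frac{f_{\mathrm{mid}}(z_{\mathrm r})\log(z_{\mathrm r})\,z_{\mathrm r}}{\mathbb{P}(Z_\nu>z_{\mathrm r})},\qquad \lambda_{\mathrm l}=1+\frac{f_{\mathrm{mid}}(z_{\mathrm l})\log(1/z_{\mathrm l})\,z_{\mathrm l}}{\mathbb{P}(Z_\nu<z_{\mathrm l})}.$$ Then for $z>0$ $$f_{\nu,c}(z)=\begin{cases} f_{\mathrm{mid}}(z) & z_{\mathrm l}\le z\le z_{\mathrm r},\\ f_{\mathrm{mid}}(z_{\mathrm r})\dfrac{z_{\mathrm r}}{z}\Big(\dfrac{\log z_{\mathrm r}}{\log z}\Big)^{\lambda_{\mathrm r}} & z>z_{\mathrm r},\\ f_{\mathrm{mid}}(z_{\mathrm l})\dfrac{z_{\mathrm l}}{z}\Big(\dfrac{\log(1/z_{\mathrm l})}{\log(1/z)}\Big)^{\lambda_{\mathrm l}} & 0<z<z_{\mathrm l}.\end{cases}$$ Model: $n,p\ge1$ integers, $\mathbf{x}_1,\dots,\mathbf{x}_n\in\mathbb{R}^p$ fixed;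 given $\boldsymbol\beta\in\mathbb{R}^p$, the positive random variables $Y_1,\dots,Y_n$ are independent and $Y_i/\mu_i$ has density $f_{\nu,c}$, where $\mu_i=\exp(\mathbf{x}_i^T\boldsymbol\beta)$. Data indexed by $\omega>0$: $\mathrm{O}\subseteq\{1,\dots,n\}$ is the fixed set of outlier indices and $\mathrm{O}^{\mathsf c}$ its complement. For $i\in\mathrm{O}^{\mathsf c}$, $y_i=a_i$ with $a_i>0$ constant. Each $i\in\mathrm{O}$ is either a large outlier, with $y_i=b_i\omega$, or a small outlier, with $y_i=1/(b_i\omega)$, where $b_i\ge1$ is a constant (the type of each outlier is fixed). Put $\mathbf{y}=(y_1,\dots,y_n)^T$ and $\mathbf{y}_{\mathrm{O}^{\mathsf c}}=\{y_i:i\in\mathrm{O}^{\mathsf c}\}$. The prior of $\boldsymbol\beta$ is assumed to have a density $\pi(\boldsymbol\beta)$ on $\mathbb{R}^p$. Define $$m_\omega(\mathbf{y})=\int_{\mathbb{R}^p}\pi(\boldsymbol\beta)\prod_{i=1}^n\frac1{\mu_i}f_{\nu,c}\Big(\frac{y_i}{\mu_i}\Big)d\boldsymbol\beta,\qquad m(\mathbf{y}_{\mathrm{O}^{\mathsf c}})=\int_{\mathbb{R}^p}\pi(\boldsymbol\beta)\prod_{i\in\mathrm{O}^{\mathsf c}}\frac1{\mu_i}f_{\nu,c}\Big(\frac{y_i}{\mu_i}\Big)d\boldsymbol\beta,$$ and, these being finite under the hypotheses, the probability densities (and associated distributions, denoted the same way) $$\pi_\omega(\boldsymbol\beta\mid\mathbf{y})=\frac{\pi(\boldsymbol\beta)\prod_{i=1}^n\frac1{\mu_i}f_{\nu,c}(y_i/\mu_i)}{m_\omega(\mathbf{y})},\qquad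 \pi(\boldsymbol\beta\mid\mathbf{y}_{\mathrm{O}^{\mathsf c}})=\frac{\pi(\boldsymbol\beta)\prod_{i\in\mathrm{O}^{\mathsf c}}\frac1{\mu_i}f_{\nu,c}(y_i/\mu_i)}{m(\mathbf{y}_{\mathrm{O}^{\mathsf c}})}.$$ A real random variable $X$ is sub-exponential if its sub-exponential norm $\|X\|_{\psi_1}=\inf\{t>0:\mathbb{E}[\exp(|X|/t)]\le2\}$ is finite. *)

(* Defs.v *)
From HB Require Import structures.
From mathcomp Require Import all_boot all_order all_algebra.
From mathcomp Require Import all_classical all_reals all_analysis.

Set Implicit Arguments.
Unset Strict Implicit.
Unset Printing Implicit Defensive.

Import Order.TTheory GRing.Theory Num.Def Num.Theory.
Import numFieldNormedType.Exports.

Local Open Scope classical_set_scope.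
Local Open Scope ring_scope.

(* R^p is [p.-tuple R] with the library's product sigma-algebra. The library  *)
(* has no Lebesgue measure on it: it is built here by iterating the binary    *)
(* product measure; [lebesgue_tuple_box] characterises it.                    *)
Section lebesgue_cons.
Context (R : realType) (p : nat).

Definition cons_pair (u : R * p.-tuple R) : p.+1.-tuple R :=
  [the p.+1.-tuple R of u.1 :: u.2].

Definition uncons (t : p.+1.-tuple R) : R * p.-tuple R :=
  (thead t, [tuple of behead t] : p.-tuple R).

Lemma cons_pairK : cancel cons_pair uncons.
Proof.
by move=> [x t]; rewrite /uncons theadE; congr pair; exact: val_inj.
Qed.

Lemma measurable_cons_pair : measurable_fun [set: R * p.-tuple R] cons_pair.
Proof. exact: measurable_cons. Qed.

Lemma measurable_uncons : measurable_fun [set: p.+1.-tuple R] uncons.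
Proof.
apply: measurable_fun_pair; last exact: measurable_behead.
exact: (@measurable_tnth _ R p.+1 ord0).
Qed.

Variable m : {sigma_finite_measure set (p.-tuple R) -> \bar R}.

Definition lebesgue_cons : set (p.+1.-tuple R) -> \bar R :=
  pushforward (@lebesgue_measure R \x m)%E cons_pair.

Let lebesgue_cons0 : lebesgue_cons set0 = 0%E.
Proof. by rewrite /lebesgue_cons /pushforward preimage_set0 measure0. Qed.

Let lebesgue_cons_ge0 A : (0 <= lebesgue_cons A)%E.
Proof. by rewrite /lebesgue_cons /pushforward measure_ge0. Qed.

Let lebesgue_cons_sigma_additive : semi_sigma_additive lebesgue_cons.
Proof.
move=> F mF tF mUF; rewrite /lebesgue_cons /pushforward preimage_bigcup.
apply: measure_semi_sigma_additive.
- by move=> n; rewrite -[X in measurable X]setTI; exact: measurable_cons_pair.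
- apply/trivIsetP => /= i j _ _ ij; rewrite -preimage_setI.
  by move/trivIsetP : tF => /(_ _ _ _ _ ij) ->//; rewrite preimage_set0.
- rewrite -preimage_bigcup -[X in measurable X]setTI.
  exact: measurable_cons_pair.
Qed.

HB.instance Definition _ := isMeasure.Build _ _ _ lebesgue_cons
  lebesgue_cons0 lebesgue_cons_ge0 lebesgue_cons_sigma_additive.

Let lebesgue_cons_sigma_finite : sigma_finite setT lebesgue_cons.
Proof.
have /sigma_finiteP[F [TF ndF Foo]] := sigma_finiteT (@lebesgue_measure R).
have /sigma_finiteP[G [TG ndG Goo]] := sigma_finiteT m.
exists (fun n => uncons @^-1` (F n `*` G n)).
  rewrite -preimage_bigcup (_ : \bigcup_i _ = setT) ?preimage_setT//.
  apply/seteqP; split=> // -[x t] _.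
  have [n _ Fnx] : (\bigcup_i F i) x by rewrite -TF.
  have [k _ Gkt] : (\bigcup_i G i) t by rewrite -TG.
  exists (maxn n k) => //; split.
    by move: x Fnx; exact/subsetPset/ndF/leq_maxl.
  by move: t Gkt; exact/subsetPset/ndG/leq_maxr.
move=> n; have [mF F_oo] := Foo n; have [mG G_oo] := Goo n; split.
  by rewrite -[X in measurable X]setTI; apply: measurable_uncons => //;
    exact: measurableX.
rewrite /lebesgue_cons /pushforward -comp_preimage.
rewrite (_ : uncons \o cons_pair = id); last first.
  by apply/funext => u; exact: cons_pairK.
by rewrite preimage_id product_measure1E// lte_mul_pinfty// ge0_fin_numE.
Qed.

HB.instance Definition _ := @Measure_isSigmaFinite.Build _ _ _ lebesgue_cons
  lebesgue_cons_sigma_finite.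

End lebesgue_cons.

Fixpoint lebesgue_tuple (R : realType) (p : nat) :
    {sigma_finite_measure set (p.-tuple R) -> \bar R} :=
  match p with
  | 0 => dirac ([tuple] : 0.-tuple R)
  | q.+1 => lebesgue_cons (lebesgue_tuple R q)
  end.

Lemma lebesgue_tuple_box (R : realType) (p : nat) (A : 'I_p -> set R) :
    (forall j, measurable (A j)) ->
  lebesgue_tuple R p [set b | forall j, A j (tnth b j)] =
  (\prod_(j < p) lebesgue_measure (A j))%E.
Proof.
elim: p A => [|p IHp] A mA.
  by rewrite big_ord0 /= diracE mem_set// => -[].
rewrite big_ord_recl -IHp; last by move=> j; exact: mA.
rewrite -product_measure1E//; last first.
  rewrite (_ : [set _ | _] =
    \bigcap_(j in [set: 'I_p]) ((fun b => tnth b j) @^-1` A (lift ord0 j))).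
    apply: fin_bigcap_measurable => // j _.
    by rewrite -[X in measurable X]setTI; exact: measurable_tnth.
  apply/seteqP; split => b bA j; first by move=> _; exact: bA.
  exact: (bA j I).
  exact: mA.
rewrite /= /lebesgue_cons /pushforward; congr (_ _).
apply/seteqP; split => -[x t] /=.
  move=> xtA; split; first exact: (xtA ord0).
  by move=> j; have := xtA (lift ord0 j); rewrite tnthS.
move=> [x0 tA] j; case: (unliftP ord0 j) => [k ->|->]; last exact: x0.
by rewrite tnthS; exact: tA.
Qed.

Section robust_gamma_density.
Context (R : realType).
Implicit Types (nu c z : R).

Definition Gamma_fun nu : R :=
  \int[lebesgue_measure]_(t in `]0, +oo[) (t `^ (nu - 1) * expR (- t)).

Definition f_mid nu z : R :=
  expR (- (nu * z)) * z `^ (nu - 1) * nu `^ nu / Gamma_fun nu.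

(* The law of Z_nu: gamma with mean 1 and shape nu. *)
Definition gamma_pdf nu : R -> R := f_mid nu \_ `]0, +oo[.

Definition gamma_prob nu (A : set R) : \bar R :=
  (\int[lebesgue_measure]_(z in A) (gamma_pdf nu z)%:E)%E.

Definition z_r nu c : R := 1 + c / sqrtr nu.
Definition z_l nu c : R := 1 - c / sqrtr nu.

Definition lambda_r nu c : R :=
  1 + f_mid nu (z_r nu c) * ln (z_r nu c) * z_r nu c /
      fine (gamma_prob nu `]z_r nu c, +oo[).

Definition lambda_l nu c : R :=
  1 + f_mid nu (z_l nu c) * ln ((z_l nu c)^-1) * z_l nu c /
      fine (gamma_prob nu `]-oo, z_l nu c[).

(* Extended by 0 to z <= 0, since it is the density of a positive variable. *)
Definition f_rob nu c z : R :=
  if z <= 0 then 0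
  else if z < z_l nu c then
    f_mid nu (z_l nu c) * (z_l nu c / z) *
      (ln ((z_l nu c)^-1) / ln (z^-1)) `^ lambda_l nu c
  else if z <= z_r nu c then f_mid nu z
  else
    f_mid nu (z_r nu c) * (z_r nu c / z) *
      (ln (z_r nu c) / ln z) `^ lambda_r nu c.

End robust_gamma_density.

Section probability_notions.
Context d (T : measurableType d) (R : realType).

Definition density_distribution (m : set T -> \bar R) (h : T -> R)
    (A : set T) : \bar R :=
  (\int[m]_(t in A) (h t)%:E)%E.

Definition has_density (m : set T -> \bar R) (P : set T -> \bar R)
    (h : T -> R) : Prop :=
  [/\ measurable_fun setT h, (forall t, 0 <= h t) &
      forall A, measurable A -> P A = density_distribution m h A].

Definition mutually_independent (P : probability T R) (p : nat)
    (X : 'I_p -> T -> R) : Prop :=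
  forall (J : {set 'I_p}) (A : 'I_p -> set R),
    (forall j, measurable (A j)) ->
    P (\bigcap_(j in [set` J]) X j @^-1` A j) =
    (\prod_(j in J) P (X j @^-1` A j))%E.

Definition psi1_norm (P : probability T R) (X : T -> R) : \bar R :=
  ereal_inf [set t%:E | t in
    [set t : R | 0 < t /\ ('E_P[fun w => expR (`|X w| / t)] <= 2%:E)%E]].

Definition sub_exponential (P : probability T R) (X : T -> R) : Prop :=
  (psi1_norm P X < +oo)%E.

End probability_notions.

(* Weak convergence on R^p: convergence of the integrals of the bounded       *)
(* continuous functions. Tuples carry no topology in the library, so test     *)
(* functions live on row vectors.                                             *)
Definition cvg_in_distribution (R : realType) (p : nat) (I : Type)
    (F : set_system I) (P : I -> set (p.-tuple R) -> \bar R)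
    (Q : set (p.-tuple R) -> \bar R) : Prop :=
  forall g : 'rV[R]_p -> R,
    continuous g -> (exists M : R, forall v, `|g v| <= M) ->
    (\int[P i]_b (g (\row_j tnth b j))%:E)%E @[i --> F] -->
    (\int[Q]_b (g (\row_j tnth b j))%:E)%E.

Section model.
Context (R : realType) (n p : nat).
Implicit Types (nu c : R) (x : 'I_n -> p.-tuple R) (b : p.-tuple R)
  (y : 'I_n -> R) (prior : p.-tuple R -> R) (I : {set 'I_n}).

Definition mean_response x b (i : 'I_n) : R :=
  expR (\sum_(j < p) tnth (x i) j * tnth b j).

Definition likelihood nu c x I y b : R :=
  \prod_(i in I) ((mean_response x b i)^-1 *
                  f_rob nu c (y i / mean_response x b i)).

Definition marginal nu c x prior I y : \bar R :=
  (\int[lebesgue_tuple R p]_b (prior b * likelihood nu c x I y b)%:E)%E.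

Definition posterior nu c x prior I y b : R :=
  prior b * likelihood nu c x I y b / fine (marginal nu c x prior I y).

(* Outliers are the indices in O; [large i] tells the large ones from the     *)
(* small ones and is irrelevant outside O.                                    *)
Definition data (O : {set 'I_n}) (large : 'I_n -> bool) (a k : 'I_n -> R)
    (w : R) (i : 'I_n) : R :=
  if i \in O then (if large i then k i * w else (k i * w)^-1) else a i.

End model.

(* Main.v *)
Require Import Defs.
From HB Require Import structures.
From mathcomp Require Import all_boot all_order all_algebra.
From mathcomp Require Import all_classical all_reals all_analysis.
From mathcomp Require Import measurable_realfun ring lra.

(** With [h u = e^u f(e^u)], where [f] is the robust density, an observation
    [y] contributes [mu^-1 f(y / mu) = y^-1 h(ln y - eta)] to the likelihood,
    [eta] being the linear predictor. The function [h] is bounded and equals a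
    multiple of a power [|u|^-lambda] far from 0 on each side. Hence, for an
    outlier [y], the ratio [h(ln y - eta) / h(ln y)] tends to 1 as [ln y] goes
    to infinity, and it is at most [C (1 + |eta|)^lambda]: either [ln y - eta]
    is comparable with [ln y], or [|eta| >= |ln y| / 2] and the power pays for
    [h] being small at [ln y]. The product of these bounds over the outliers
    is at most a constant times [exp (eps * sum_i |eta_i|)], for any [eps > 0],
    and for [eps] small this is below [exp (|beta_j| / t_j)] for the index [j]
    maximising [|beta_j|], hence below the sum over [j], which has a finite
    prior expectation. Dominated convergence then gives (a), (b) and (c). *)

Set Implicit Arguments.
Unset Strict Implicit.
Unset Printing Implicit Defensive.

Import Order.TTheory GRing.Theory Num.Def Num.Theory.
Import numFieldNormedType.Exports.

Local Open Scope classical_set_scope.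
Local Open Scope ring_scope.

(** * Integration *)

Section density_measure.
Context d (T : measurableType d) (R : realType).
Variables (mu : {measure set T -> \bar R}) (h : T -> R).
Hypotheses (mh : measurable_fun setT h) (h0 : forall t, 0 <= h t).

(* [density_distribution mu h] again, with the hypotheses on [h] as arguments so
   that a measure instance can be attached to it. *)
Definition density_measure (_ : measurable_fun setT h)
  (_ : forall t, 0 <= h t) := density_distribution mu h.

Local Notation nu := (density_measure mh h0).

Let nu_set0 : nu set0 = 0%E.
Proof. by rewrite /nu /density_distribution integral_set0. Qed.

Let nu_ge0 A : (0 <= nu A)%E.
Proof. by apply: integral_ge0 => x _; rewrite lee_fin. Qed.

Let nu_sigma_additive : semi_sigma_additive nu.
Proof.
move=> A mA tA mUA.
rewrite /nu /density_distribution ge0_integral_bigcup//.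
- apply: is_cvg_ereal_nneg_natsum_cond => n _ _.
  exact: nu_ge0.
- apply/measurable_EFinP; exact: measurable_funTS.
- by move=> x _; rewrite lee_fin.
Qed.

HB.instance Definition _ := isMeasure.Build _ _ _ nu
  nu_set0 nu_ge0 nu_sigma_additive.

Import HBNNSimple.
Local Open Scope ereal_scope.

(** By monotone convergence both sides are limits of integrals involving the simple functions [s n]
    that approximate [f]. Linearity then leaves the indicator of one level set, for which the claim
    is the definition of [nu]. *)
Let ge0_integral_density (f : T -> R) :
    measurable_fun setT f -> (forall x, (0 <= f x)%R) ->
  \int[nu]_x (f x)%:E = \int[mu]_x (f x * h x)%:E.
Proof.
move=> mf f0.
have mf' : measurable_fun setT (EFin \o f) by exact/measurable_EFinP.
have f0' x : [set: T] x -> 0 <= (EFin \o f) x by rewrite /= lee_fin.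
pose s := nnsfun_approx measurableT mf'.
have mhE : measurable_fun [set: T] (EFin \o h) by exact/measurable_EFinP.
have -> : \int[nu]_x (f x)%:E =
    lim (\int[nu]_x (EFin \o s n) x @[n --> \oo]).
  have fE x : (f x)%:E = lim ((EFin \o s n) x @[n --> \oo]).
    apply/esym/cvg_lim => //.
    exact: (@cvg_nnsfun_approx _ _ _ _ measurableT _ mf').
  under eq_integral => x _ do rewrite fE.
  apply: (@monotone_convergence _ _ _ nu) => //.
  - by move=> n; apply/measurable_EFinP.
  - by move=> n x Ex //=; rewrite lee_fin.
  - by move=> x Ex a b ab; rewrite lee_fin; exact/lefP/nd_nnsfun_approx.
have -> : \int[mu]_x (f x * h x)%:E =
    lim (\int[mu]_x ((EFin \o s n) x * (h x)%:E) @[n --> \oo]).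
  have fE x : (f x * h x)%:E = lim ((EFin \o s n) x * (h x)%:E @[n --> \oo]).
    apply/esym/cvg_lim => //; rewrite EFinM; apply: cvgeZr => //.
    exact: (@cvg_nnsfun_approx _ _ _ _ measurableT _ mf').
  under eq_integral => x _ do rewrite fE.
  apply: monotone_convergence => [//| | |].
  - by move=> n; apply/emeasurable_funM => //; exact/measurable_EFinP.
  - by move=> n x Ex /=; rewrite mule_ge0 ?lee_fin.
  - move=> x Ex a b ab/=; rewrite lee_wpmul2r ?lee_fin//.
    exact/lefP/nd_nnsfun_approx.
suff suf n : \int[mu]_x ((EFin \o s n) x * (h x)%:E) =
    \int[nu]_x (EFin \o s n) x.
  by congr (lim (_ @ \oo)); apply/funext => n; exact/esym/suf.
transitivity (\int[nu]_x
   (\sum_(y \in range (s n)) (y * \1_(s n @^-1` [set y]) x)%:E)); last first.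
  by apply: eq_integral => t tE; rewrite /= fimfunE -fsumEFin.
have indich m r : measurable_fun setT (fun x => (r * \1_(s m @^-1` [set r]) x)%:E).
  by apply: (measurable_comp measurableT) => //; exact: measurable_funM.
rewrite ge0_integral_fsum//; last by move=> m y Ey; exact: nnfun_muleindic_ge0.
transitivity (\int[mu]_x (\sum_(y \in range (s n))
    (y * \1_(s n @^-1` [set y]) x)%:E * (h x)%:E)).
  under [RHS]eq_integral => x xE.
    rewrite -ge0_mule_fsuml => [|y]; last exact: nnfun_muleindic_ge0.
    rewrite fsumEFin // -(fimfunE _ x); over.
  by [].
rewrite ge0_integral_fsum//; last 2 first.
  - by move=> y; apply: emeasurable_funM.
  - by move=> m y Ey; rewrite mule_ge0 ?lee_fin// -lee_fin nnfun_muleindic_ge0.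
apply: eq_fsbigr => r rsn.
under [RHS]eq_integral do rewrite EFinM.
rewrite integralZl_indic_nnsfun => //.
under eq_integral do rewrite EFinM -muleA.
rewrite ge0_integralZl//.
- under eq_integral do rewrite muleC.
  rewrite (eq_integral ((EFin \o h) \_ (s n @^-1` [set r]))); last first.
    by move=> x xE; rewrite epatch_indic.
  by rewrite -integral_mkcondr integral_indic// setTI setIT.
- by apply: emeasurable_funM => //; exact/measurable_EFinP.
- by move=> t Et; rewrite mule_ge0 ?lee_fin.
- by move: rsn; rewrite inE => -[t _ <-]; rewrite lee_fin.
Qed.

(** As [h] is nonnegative, the positive and negative parts of [f * h] are those of [f] times [h], so
    the nonnegative case applies to each part. *)
Lemma integral_density (f : T -> R) : measurable_fun setT f ->
  \int[density_distribution mu h]_x (f x)%:E = \int[mu]_x (f x * h x)%:E.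
Proof.
move=> mf; rewrite (@integralE _ _ _ nu) [RHS]integralE; congr (_ - _).
- transitivity (\int[nu]_x (maxr (f x) 0)%:E).
    by apply: eq_integral => x _; rewrite funeposE /= -EFin_max.
  rewrite ge0_integral_density; first last.
  - by move=> x; rewrite le_max lexx orbT.
  - by apply: measurable_maxr.
  apply: eq_integral => x _; rewrite funeposE -EFin_max maxr_pMl// mul0r//.
- transitivity (\int[nu]_x (maxr (- f x) 0)%:E).
    by apply: eq_integral => x _; rewrite funenegE /= -EFin_max.
  rewrite ge0_integral_density; first last.
  - by move=> x; rewrite le_max lexx orbT.
  - by apply: measurable_maxr => //; exact: measurableT_comp.
  by apply: eq_integral => x _; rewrite funenegE -EFin_max maxr_pMl// mul0r mulNr.
Qed.

End density_measure.

Section dominated_convergence_pinfty.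
Context d (T : measurableType d) (R : realType) (mu : {measure set T -> \bar R}).

(** A limit at infinity is tested along the sequences tending to infinity, which brings the claim
    back to the sequential theorem. *)
Lemma dominated_convergence_pinfty (f : R -> T -> R) (l g : T -> R) :
    (forall w, measurable_fun setT (f w)) ->
    (forall x, f w x @[w --> +oo] --> l x) ->
    mu.-integrable setT (EFin \o g) ->
    (\forall w \near +oo, forall x, `|f w x| <= g x) ->
  (\int[mu]_x (f w x)%:E)%E @[w --> +oo] --> (\int[mu]_x (l x)%:E)%E.
Proof.
move=> mf fl ig [A [Ar fg]].
apply/cvge_pinftyP => u uoo.
(* The domination holds only beyond [A], so the sequence is shifted past the last index at which it
   may lie below [A]. *)
have [N _ NA] : \forall n \near \oo, A < u n by move/cvgryPgt : uoo; exact.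
rewrite -(cvg_shiftn N).
have fu x : f (u (n + N)%N) x @[n --> \oo] --> l x.
  by rewrite (cvg_shiftn N (fun n => f (u n) x)); move/cvg_pinftyP : (fl x); exact.
have [] // := @dominated_convergence _ _ _ mu setT measurableT
  (fun n x => (f (u (n + N)%N) x)%:E) (EFin \o l) (EFin \o g).
- by move=> n; exact/measurable_EFinP.
- apply/measurable_EFinP.
  by apply: (@measurable_fun_cvg _ _ _ _ (fun n => f (u (n + N)%N))).
- apply: aeW => x _; apply/fine_cvgP; split; first by near=> n.
  exact: fu.
- apply: aeW => x n _ /=; rewrite lee_fin; apply: fg; apply: NA.
  by rewrite /= leq_addl.
Unshelve. all: by end_near. Qed.

End dominated_convergence_pinfty.

(** * Measurability of continuous functions of the coordinates *)

Section measurable_row.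
Context (R : realType) (p : nat).

(** Rounding down to the multiples of 1/(k+1): the rounded points are countably many, and they
    approach the original point as [k] grows. *)
Let grid (k : nat) (x : R) : R := (Num.floor (x * k.+1%:R))%:~R / k.+1%:R.

Let measurable_grid k : measurable_fun setT (grid k).
Proof.
apply: nondecreasing_measurable => // x y xy.
rewrite /grid ler_wpM2r ?invr_ge0// ler_int; apply: le_floor.
by rewrite ler_wpM2r.
Qed.

Let gridP k x : `|x - grid k x| <= k.+1%:R^-1.
Proof.
have k0 : 0 < k.+1%:R :> R by rewrite ltr0n.
have [lo hi] : grid k x <= x /\ x <= grid k x + k.+1%:R^-1.
  split; rewrite /grid; first by rewrite ler_pdivrMr// floor_le_tmp.
  rewrite -[X in _ + X]mul1r -mulrDl ler_pdivlMr// ltW//.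
  by have := floorD1_gt (x * k.+1%:R); rewrite intrD.
by rewrite ger0_norm ?subr_ge0// lerBlDl.
Qed.

(** Rounded points are indexed by integer tuples, so a preimage is a countable union of cells, each
    cut out by finitely many coordinate conditions. *)
Let measurable_grid_comp (g : 'rV[R]_p -> R) k :
  measurable_fun setT (fun b : p.-tuple R => g (\row_j grid k (tnth b j))).
Proof.
move=> _ Y mY; rewrite setTI.
pose pt (t : p.-tuple int) (j : 'I_p) : R := (tnth t j)%:~R / k.+1%:R.
pose cell (t : p.-tuple int) : set (p.-tuple R) :=
  [set b | forall j, grid k (tnth b j) = pt t j].
have mcell t : measurable (cell t).
  rewrite (_ : cell t =
    \bigcap_(j in [set: 'I_p]) ((fun b => grid k (tnth b j)) @^-1` [set pt t j])).
    apply: fin_bigcap_measurable => // j _.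
    rewrite -[X in measurable X]setTI.
    apply: (measurableT_comp (measurable_grid k)) => //.
    exact: measurable_tnth.
  apply/seteqP; split => b bA j; first by move=> _; exact: bA.
  exact: (bA j I).
(* The union runs over the codes of integer tuples; a number that codes no tuple contributes the
   empty set. *)
pose F n : set (p.-tuple R) :=
  if (unpickle n : option (p.-tuple int)) is Some t then
    if g (\row_j pt t j) \in Y then cell t else set0 else set0.
rewrite (_ : _ @^-1` _ = \bigcup_n F n).
  apply: bigcupT_measurable => n; rewrite /F.
  by case: unpickle => [t|//]; case: ifP.
apply/seteqP; split => [b Yb|b [n _]].
  exists (pickle [tuple Num.floor (tnth b j * k.+1%:R) | j < p]) => //.
  rewrite /F pickleK /= (_ : \row_j _ = \row_j grid k (tnth b j)).
    by rewrite mem_set// => j; rewrite /pt tnth_mktuple.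
  by apply/rowP => j; rewrite !mxE /pt tnth_mktuple.
rewrite /F; case: unpickle => [t|//]; case: ifPn => // + bt.
rewrite inE /= (_ : \row_j grid k (tnth b j) = \row_j pt t j)//.
by apply/rowP => j; rewrite !mxE bt.
Qed.

(** By continuity, [g] is the pointwise limit of its values at the rounded points. *)
Lemma measurable_continuous_row (g : 'rV[R]_p -> R) : continuous g ->
  measurable_fun setT (fun b : p.-tuple R => g (\row_j tnth b j)).
Proof.
move=> cg; apply: (@measurable_fun_cvg _ _ _ _
  (fun k b => g (\row_j grid k (tnth b j)))) => // b _.
apply: (@cvg_comp _ _ _ (fun k => \row_j grid k (tnth b j)) g _ _ _ _ (cg _)).
apply/cvg_ballP => e e0; near=> k.
rewrite /= /ball /= /mx_ball; split => // i j; rewrite !mxE.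
rewrite /ball /= (le_lt_trans (gridP _ _))//.
near: k; exact: near_infty_natSinv_lt (PosNum e0).
Unshelve. all: by end_near. Qed.

End measurable_row.

(** If the last integral vanished, [f * g] would be zero almost everywhere on [D], and so would [f],
    since [g] is positive there. *)
Lemma integral_mul_gt0 d (T : measurableType d) (R : realType)
    (mu : {measure set T -> \bar R}) (D : set T) (f g : T -> R) :
    measurable D -> measurable_fun D f -> measurable_fun D g ->
    (forall x, D x -> 0 <= f x) -> (forall x, D x -> 0 < g x) ->
    (0 < \int[mu]_(x in D) (f x)%:E)%E ->
  (0 < \int[mu]_(x in D) (f x * g x)%:E)%E.
Proof.
move=> mD mf mg f0 g0 If0.
have If_ge0 : (0 <= \int[mu]_(x in D) (f x * g x)%:E)%E.
  by apply: integral_ge0 => x Dx; rewrite lee_fin mulr_ge0 ?f0// ltW ?g0.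
rewrite lt_neqAle If_ge0 andbT; apply/negP => /eqP fg0.
move: If0; suff -> : (\int[mu]_(x in D) (f x)%:E = 0)%E by rewrite ltxx.
transitivity (\int[mu]_(x in D) `|(f x)%:E|)%E.
  by apply: eq_integral => x /set_mem Dx; rewrite gee0_abs// lee_fin f0.
apply/ae_eq_integral_abs => //; first exact/measurable_EFinP.
have : ae_eq mu D (fun x => (f x * g x)%:E) (cst 0%E).
  apply/ae_eq_integral_abs => //.
    by apply/measurable_EFinP; exact: measurable_funM.
  rewrite fg0; apply: eq_integral => x /set_mem Dx.
  by rewrite gee0_abs// lee_fin mulr_ge0 ?f0// ltW ?g0.
apply: filterS => x fgx0 Dx; have [/eqP] := fgx0 Dx.
by rewrite mulf_eq0 (gt_eqF (g0 _ Dx)) orbF => /eqP ->.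
Qed.

(** Applying [ln v < v] to [v = de * (1 + u)] bounds [ln (1 + u)] by an affine function of slope
    [de], and [la * de <= eps]. The [+ 1] in [de] avoids a division by zero when [la = 0]. *)
Lemma powR_le_expR (R : realType) (la eps : R) : 0 <= la -> 0 < eps ->
  exists2 C, 0 < C & forall u, 0 <= u -> (1 + u) `^ la <= C * expR (eps * u).
Proof.
move=> la0 eps0; pose de := eps / (la + 1).
have la1 : 0 < la + 1 by lra.
have de0 : 0 < de by rewrite divr_gt0.
exists (expR (la * (de - ln de))); first exact: expR_gt0.
move=> u u0; have u1 : 0 < 1 + u by lra.
rewrite /powR gt_eqF// -expRD ler_expR.
have lnle : ln (1 + u) <= de * (1 + u) - ln de.
  have -> : ln (1 + u) = ln (de * (1 + u)) - ln de.
    by rewrite lnM ?posrE// addrAC subrr add0r.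
  by rewrite lerD2r ltW// ln_sublinear// mulr_gt0.
apply: (le_trans (ler_wpM2l la0 lnle)).
have : la * de <= eps by rewrite /de mulrCA ler_piMr ?(ltW eps0)// ler_pdivrMr// mul1r; lra.
by move=> /(ler_wpM2r u0); lra.
Qed.

(** On each open half-line the inverse is, up to sign, the exponential of minus a logarithm; the
    last branch is the convention [0^-1 = 0]. *)
Lemma measurable_invr (R : realType) : measurable_fun setT (fun x : R => x^-1).
Proof.
have -> : (fun x : R => x^-1) = (fun x => if 0 < x then expR (- ln x) else
    if x < 0 then - expR (- ln (- x)) else 0).
  apply/funext => x; have [x0|] := ltP 0 x.
    by rewrite expRN lnK.
  rewrite le_eqVlt => /predU1P[->|x0]; first by rewrite ltxx invr0.
  by rewrite x0 expRN lnK ?posrE ?oppr_gt0// invrN opprK.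
have mln := @measurable_ln R.
apply: measurable_fun_ifT; first exact: measurable_fun_ltr.
  by apply: measurableT_comp => //; exact: measurableT_comp.
apply: measurable_fun_ifT => //; first exact: measurable_fun_ltr.
apply: measurableT_comp => //; apply: measurableT_comp => //.
by apply: measurableT_comp => //; exact: measurableT_comp.
Qed.

(** The real-valued integral would be 0 if the extended one were infinite, so finiteness is proved
    along with positivity: the integrand is at most a multiple of the exponential density of rate
    1/2. *)
Lemma Gamma_fun_gt0 (R : realType) (nu : R) : 1 < nu -> 0 < Gamma_fun nu.
Proof.
move=> nu1.
pose f (t : R) := t `^ (nu - 1) * expR (- t).
have mf D : measurable_fun D f.
  apply: measurable_funTS; apply: measurable_funM; first exact: measurable_powR.
  by apply: measurableT_comp => //; exact: measurableT_comp.
have If0 : (0 < \int[lebesgue_measure]_(t in `]0%R, +oo[) (f t)%:E)%E.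
  (* The factor 1 fits [integral_mul_gt0]: its integral is the infinite length of the half-line. *)
  have -> : (\int[lebesgue_measure]_(t in `]0%R, +oo[) (f t)%:E =
      \int[lebesgue_measure]_(t in `]0%R, +oo[) (cst 1%R t * f t)%:E)%E.
    by apply: eq_integral => t _; rewrite /= mul1r.
  apply: integral_mul_gt0 => //.
    exact: mf.
    move=> x; rewrite /= in_itv/= andbT => x0.
    by rewrite mulr_gt0 ?powR_gt0 ?expR_gt0.
  rewrite (integral_cst lebesgue_measure _ 1%:E)//=.
  by rewrite mul1e lebesgue_measure_itv/= ltry oppr0 adde0 ltry.
apply: fine_gt0; rewrite If0/=.
have [||C C0 fC] := @powR_le_expR R (nu - 1) 2^-1; [lra..|].
apply: (@le_lt_trans _ _ (\int[lebesgue_measure]_t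
    ((2 * C)%:E * (exponential_pdf 2^-1 t)%:E))%E).
  rewrite [leLHS]integral_mkcond; apply: ge0_le_integral => //.
  - move=> x _; apply: erestrict_ge0 => {}x _.
    by rewrite lee_fin mulr_ge0 ?powR_ge0 ?expR_ge0.
  - apply/measurable_restrict => //; rewrite setIidr//.
    by apply/measurable_EFinP; exact: mf.
  - apply: emeasurable_funM => //; apply/measurable_EFinP.
    exact: measurable_exponential_pdf.
  - move=> x _; rewrite patchE; case: ifPn => [|_].
      rewrite inE /= in_itv/= andbT => x0; rewrite -EFinM lee_fin.
      rewrite (exponential_pdfE _ (ltW x0)).
      have -> : expR (- 2^-1 * x) = expR (2^-1 * x) * expR (- x).
        by rewrite -expRD; congr expR; field.
      rewrite (_ : 2 * C * _ = C * expR (2^-1 * x) * expR (- x)); last by field.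
      rewrite /f ler_wpM2r ?expR_ge0// (le_trans _ (fC x (ltW x0)))//.
      by rewrite ge0_ler_powR ?nnegrE; lra.
    rewrite -[point]/(0%:E) -EFinM lee_fin mulr_ge0// ?exponential_pdf_ge0 ?invr_ge0//.
    by rewrite mulr_ge0 // ltW.
rewrite ge0_integralZl//.
- rewrite integral_exponential_pdf ?invr_gt0// mule1 ltry//.
- by apply/measurable_EFinP; exact: measurable_exponential_pdf.
- by move=> x _; rewrite lee_fin exponential_pdf_ge0 ?invr_ge0.
- by rewrite lee_fin mulr_ge0// ltW.
Qed.

(** * Power tails *)

Lemma powR_ge1 (R : realType) (a x : R) : 1 <= a -> 0 <= x -> 1 <= a `^ x.
Proof. by move=> a1 x0; rewrite -(powRr0 a) ler_powR. Qed.

Lemma tail_shift_le (R : realType) (h : R -> R) (H A U la : R) :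
    0 < A -> 0 < U -> 0 <= la ->
    (forall u, U < u -> h u = A * (U / u) `^ la) ->
    (forall u, 0 <= h u <= H) ->
  exists2 C, 0 <= C & forall s e, 2 * U < s ->
    h (s - e) <= C * (1 + `|e|) `^ la * h s.
Proof.
move=> A0 U0 la0 hE hH; have H0 : 0 <= H by have /andP[/le_trans] := hH 0; apply.
(* The first summand serves the case [s / 2 < s - e], the second the case where [e] is at least
   [s / 2]. *)
exists (2 `^ la + (H / A) * (2 / U) `^ la).
  by rewrite addr_ge0 ?mulr_ge0 ?powR_ge0 ?invr_ge0 ?(ltW A0).
move=> s e Us; have s0 : 0 < s by lra.
have e0 := normr_ge0 e.
have e1 : 1 <= (1 + `|e|) `^ la by rewrite powR_ge1//; lra.
have Us0 : 0 < (U / s) `^ la by rewrite powR_gt0 ?divr_gt0.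
have hsE : h s = A * (U / s) `^ la by rewrite hE//; lra.
have hs0 : 0 < h s by rewrite hsE mulr_gt0.
(* As [s > 2 * U], the first case puts [s - e] in the tail, where halving the argument costs at most
   a factor [2 ^ la]. *)
rewrite -mulrA mulrDl; have [se|se] := ltP (s / 2) (s - e).
  have hse : h (s - e) <= 2 `^ la * h s.
    have se0 : 0 < s - e by lra.
    rewrite hE ?hsE; last by lra.
    rewrite mulrCA ler_pM2l// -powRM ?divr_ge0 ?(ltW U0) ?(ltW s0)//.
    have q0 : 0 <= U / (s - e) by rewrite divr_ge0 ?ltW.
    have q1 : 0 <= 2 * (U / s) by rewrite mulr_ge0 ?divr_ge0 ?ltW.
    rewrite ge0_ler_powR ?nnegrE// ler_pdivrMr//.
    have -> : 2 * (U / s) * (s - e) = U * (2 * (s - e) / s).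
      by field; rewrite gt_eqF.
    by rewrite ler_peMr ?(ltW U0)// ler_pdivlMr// mul1r; lra.
  apply: (le_trans hse); rewrite -[leLHS]addr0 lerD//.
    by rewrite ler_wpM2l ?powR_ge0// ler_peMl// ltW.
  by rewrite !mulr_ge0 ?powR_ge0 ?invr_ge0 ?(ltW A0) ?(ltW hs0)// ltW.
(* In the second case [h (s - e)] is only bounded by [H]; the power of [1 + |e|] offsets the
   smallness of [h s], as [2 * (1 + |e|) / s] is at least 1. *)
have /andP[_ /le_trans] := hH (s - e); apply.
have e2 : s / 2 <= `|e| by rewrite (le_trans _ (ler_norm _))//; lra.
rewrite -[leLHS]add0r lerD ?mulr_ge0 ?powR_ge0 ?(ltW hs0)//.
have -> : H / A * (2 / U) `^ la * ((1 + `|e|) `^ la * h s) =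
   H * ((2 / U) `^ la * (1 + `|e|) `^ la * (U / s) `^ la).
  by rewrite hsE; field; lra.
have [U0' s0'] := (ltW U0, ltW s0).
rewrite ler_peMr// -!powRM ?mulr_ge0 ?invr_ge0 ?addr_ge0//.
rewrite powR_ge1//.
have -> : 2 / U * (1 + `|e|) * (U / s) = (2 * (1 + `|e|)) / s.
  by field; rewrite !gt_eqF.
by rewrite ler_pdivlMr//; lra.
Qed.

(** Once [s] and [s - e] are both in the tail, the constants cancel and the ratio is
    [(s / (s - e)) ^ la], whose base tends to 1. *)
Lemma tail_shift_cvg (R : realType) (h : R -> R) (A U la : R) (e : R) :
    0 < A -> 0 < U -> (forall u, U < u -> h u = A * (U / u) `^ la) ->
  h (s - e) / h s @[s --> +oo] --> (1 : R).
Proof.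
move=> A0 U0 hE.
have inv0 : s^-1 @[s --> +oo] --> (0 : R).
  apply/gtr0_cvgV0; last exact: cvg_id.
  by near=> s; near: s; exact: (nbhs_pinfty_gt (num_real _)).
have ratio : (1 - e * s^-1)^-1 @[s --> +oo] --> (1 : R).
  rewrite -[X in _ --> X]invr1; apply: cvgV; first by rewrite oner_eq0.
  rewrite -[X in _ --> X]subr0 -[X in _ --> _ - X](mulr0 e).
  by apply: cvgB; [exact: cvg_cst|exact: cvgMr].
have cont : a `^ la @[a --> (1 : R)] --> (1 : R) `^ la.
  have one : (1 : R) \in `]0, +oo[ by rewrite in_itv/= ltr01.
  have : derivable (fun a : R => a `^ la) (1 : R) 1 by exact: derivable_powR.
  by move/derivable1_diffP/differentiable_continuous.
have : (1 - e * s^-1)^-1 `^ la @[s --> +oo] --> (1 : R) `^ la.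
  by apply: cvg_comp cont; exact: ratio.
rewrite powR1.
apply: cvg_trans; apply: near_eq_cvg; near=> s.
have Us : U < s by near: s; exact: (nbhs_pinfty_gt (num_real _)).
have Use : U < s - e by rewrite ltrBrDr; near: s; exact: (nbhs_pinfty_gt (num_real _)).
have s0 : 0 < s by lra. have se0 : 0 < s - e by lra.
have -> : (1 - e / s)^-1 = s / (s - e) by field; rewrite !gt_eqF.
have Us1 : 0 < U / s by rewrite divr_gt0.
rewrite !hE// -mulf_div divff ?gt_eqF// mul1r.
have -> : U / (s - e) = s / (s - e) * (U / s) by field; rewrite !gt_eqF.
rewrite (powRM _ (_ : 0 <= s / (s - e)) (ltW Us1)) ?divr_ge0 ?ltW//.
by rewrite mulfK// gt_eqF// powR_gt0.
Unshelve. all: by end_near. Qed.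

(** * The robust density *)

Section robust_density.
Context (R : realType) (nu c : R).
Hypotheses (hnu : 1 < nu) (hc : 0 < c < sqrtr nu).

Let zr := z_r nu c.
Let zl := z_l nu c.

Let q01 : 0 < c / sqrtr nu < 1.
Proof.
move: hc => /andP[c0 cnu]; have s0 : 0 < sqrtr nu := lt_trans c0 cnu.
by rewrite divr_gt0//= ltr_pdivrMr// mul1r.
Qed.

Let zr_gt1 : 1 < zr. Proof. by have /andP[] := q01; rewrite /zr /z_r; lra. Qed.
Let zl_gt0 : 0 < zl. Proof. by have /andP[] := q01; rewrite /zl /z_l; lra. Qed.
Let zl_lt1 : zl < 1. Proof. by have /andP[] := q01; rewrite /zl /z_l; lra. Qed.
Let zr_gt0 : 0 < zr. Proof. exact: lt_trans zr_gt1. Qed.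

Lemma z_r_gt1 : 1 < z_r nu c. Proof. exact: zr_gt1. Qed.

Lemma z_l_gt0 : 0 < z_l nu c. Proof. exact: zl_gt0. Qed.

Lemma z_l_lt1 : z_l nu c < 1. Proof. exact: zl_lt1. Qed.

Lemma f_mid_gt0 z : 0 < z -> 0 < f_mid nu z.
Proof.
move=> z0; have nu0 : 0 < nu by exact: lt_trans hnu.
by rewrite /f_mid divr_gt0 ?Gamma_fun_gt0// !mulr_gt0 ?expR_gt0 ?powR_gt0.
Qed.

Let lnzr_gt0 : 0 < ln zr. Proof. by rewrite ln_gt0. Qed.

Let lnzlV_gt0 : 0 < ln zl^-1. Proof. by rewrite ln_gt0// invf_gt1. Qed.

Lemma gamma_prob_ge0 A : 0 <= fine (gamma_prob nu A).
Proof.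
apply: fine_ge0; apply: integral_ge0 => x _; rewrite lee_fin.
apply: restrict_ge0 => {}x; rewrite /= in_itv/= andbT => x0.
exact: ltW (f_mid_gt0 x0).
Qed.

Lemma lambda_r_ge0 : 0 <= lambda_r nu c.
Proof.
rewrite /lambda_r -/zr addr_ge0// mulr_ge0 ?invr_ge0 ?gamma_prob_ge0//.
have fm := f_mid_gt0 zr_gt0.
by apply: mulr_ge0; [apply: mulr_ge0|]; exact: ltW.
Qed.

Lemma lambda_l_ge0 : 0 <= lambda_l nu c.
Proof.
rewrite /lambda_l -/zl addr_ge0// mulr_ge0 ?invr_ge0 ?gamma_prob_ge0//.
have fm := f_mid_gt0 zl_gt0.
by apply: mulr_ge0; [apply: mulr_ge0|]; exact: ltW.
Qed.

Lemma f_rob_gt0 z : 0 < z -> 0 < f_rob nu c z.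
Proof.
move=> z0; rewrite /f_rob leNgt z0/= -/zl -/zr.
case: (ltP z zl) => [zzl|zlz].
  apply: mulr_gt0; first by rewrite mulr_gt0 ?f_mid_gt0 ?divr_gt0.
  by rewrite powR_gt0// divr_gt0// ln_gt0// invf_gt1// (lt_trans zzl).
case: (leP z zr) => [_|zrz]; first exact: f_mid_gt0.
apply: mulr_gt0; first by rewrite mulr_gt0 ?f_mid_gt0 ?divr_gt0.
by rewrite powR_gt0// divr_gt0// ln_gt0// (lt_trans zr_gt1).
Qed.

Lemma f_rob_ge0 z : 0 <= f_rob nu c z.
Proof.
by have [z0|z0] := ltP 0 z; [rewrite ltW ?f_rob_gt0|rewrite /f_rob z0].
Qed.

Let f_rob_right z : zr < z ->
  z * f_rob nu c z = f_mid nu zr * zr * (ln zr / ln z) `^ lambda_r nu c.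
Proof.
move=> zrz; have z0 : 0 < z := lt_trans zr_gt0 zrz.
rewrite /f_rob leNgt z0/= -/zl -/zr ltNge (ltW (lt_trans _ zrz))/=; last first.
  exact: lt_trans zl_lt1 zr_gt1.
by rewrite leNgt zrz/=; field; rewrite gt_eqF.
Qed.

Let f_rob_left z : 0 < z < zl ->
  z * f_rob nu c z = f_mid nu zl * zl * (ln zl^-1 / ln z^-1) `^ lambda_l nu c.
Proof.
move=> /andP[z0 zzl]; rewrite /f_rob leNgt z0/= -/zl zzl.
by field; rewrite gt_eqF.
Qed.

(** On the scale [u = ln z] the factor [z] cancels the [1 / z] of the tail, leaving the pure power
    that [tail_shift_le] and [tail_shift_cvg] expect. *)
Lemma f_rob_right_tail u : ln zr < u -> expR u * f_rob nu c (expR u) =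
  f_mid nu zr * zr * (ln zr / u) `^ lambda_r nu c.
Proof. by move=> ru; rewrite f_rob_right ?expRK// -[zr]lnK// ltr_expR. Qed.

(** The reflection [u = - ln z] sends the left tail to +oo, so that both tails fall under the same
    lemmas. *)
Lemma f_rob_left_tail u : ln zl^-1 < u ->
  expR (- u) * f_rob nu c (expR (- u)) =
  f_mid nu zl * zl * (ln zl^-1 / u) `^ lambda_l nu c.
Proof.
move=> lu; rewrite f_rob_left; first by rewrite -expRN opprK expRK.
by rewrite expR_gt0/= -[zl]lnK// ltr_expR ltrNl -lnV.
Qed.

(** Each tail stays below its value at the junction point, and in the middle [z * f_mid nu z] is
    [K * exp (- nu * z) * z ^ nu], at most [K * zr ^ nu]. The witness adds the three bounds. *)
Lemma f_rob_bounded : exists H, forall u, 0 <= expR u * f_rob nu c (expR u) <= H.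
Proof.
pose K := nu `^ nu / Gamma_fun nu.
have G0 := Gamma_fun_gt0 hnu.
have nu0 : 0 <= nu by exact: le_trans (ltW hnu).
have K0 : 0 <= K by rewrite divr_ge0 ?powR_ge0// ltW.
have Ar0 : 0 < f_mid nu zr * zr by rewrite mulr_gt0 ?f_mid_gt0.
have Al0 : 0 < f_mid nu zl * zl by rewrite mulr_gt0 ?f_mid_gt0.
have M0 : 0 <= K * zr `^ nu by rewrite mulr_ge0 ?powR_ge0.
exists (K * zr `^ nu + f_mid nu zr * zr + f_mid nu zl * zl) => u.
rewrite mulr_ge0 ?expR_ge0 ?f_rob_ge0//=.
have powR_le1 (a b l : R) : 0 < a -> a < b -> 0 <= l -> (a / b) `^ l <= 1.
  move=> a0 ab l0; have b0 := lt_trans a0 ab.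
  have ab0 : 0 <= a / b by rewrite divr_ge0 ?ltW.
  have ab1 : a / b <= 1 by rewrite ler_pdivrMr// mul1r ltW.
  by have := ge0_ler_powR l0 ab0 ler01 ab1; rewrite powR1.
have [ur|ur] := ltP (ln zr) u.
  rewrite f_rob_right_tail//.
  have := powR_le1 _ _ _ lnzr_gt0 ur lambda_r_ge0.
  by move=> /(ler_wpM2l (ltW Ar0)); lra.
have [ul|ul] := ltP (ln zl^-1) (- u).
  have := f_rob_left_tail ul; rewrite opprK => ->.
  have := powR_le1 _ _ _ lnzlV_gt0 ul lambda_l_ge0.
  by move=> /(ler_wpM2l (ltW Al0)); lra.
have uzr : expR u <= zr by rewrite -[zr]lnK// ler_expR.
have zlu : zl <= expR u.
  by rewrite -[zl]lnK// ler_expR -lerN2 -lnV.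
rewrite /f_rob (leNgt (expR u) 0) expR_gt0/= -/zl -/zr (ltNge _ zl) zlu/= uzr.
rewrite (@le_trans _ _ (K * zr `^ nu))//; last by lra.
rewrite /f_mid.
have -> : expR u * (expR (- (nu * expR u)) * expR u `^ (nu - 1) * nu `^ nu / Gamma_fun nu)
  = K * (expR (- (nu * expR u)) * (expR u * expR u `^ (nu - 1))).
  by rewrite /K; field; rewrite gt_eqF.
rewrite ler_wpM2l// mulr_powRB1 ?expR_ge0//; last exact: lt_trans hnu.
rewrite (@le_trans _ _ (expR u `^ nu))// ?ler_piMl ?powR_ge0//.
  by rewrite -expR0 ler_expR oppr_le0 mulr_ge0 ?expR_ge0.
by rewrite ge0_ler_powR ?nnegrE ?expR_ge0// ltW.
Qed.

Lemma measurable_f_rob : measurable_fun setT (f_rob nu c).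
Proof.
have mV := @measurable_invr R; have mln := @measurable_ln R.
have mlnV : measurable_fun setT (fun z : R => (ln z)^-1).
  exact: (measurableT_comp mV).
have mlnVV : measurable_fun setT (fun z : R => (ln z^-1)^-1).
  by apply: (measurableT_comp mV); exact: measurableT_comp.
apply: measurable_fun_ifT => //; first exact: measurable_fun_ler.
apply: measurable_fun_ifT => //; first exact: measurable_fun_ltr.
  apply: measurable_funM; first by apply: measurable_funM => //; exact: measurable_funM.
  by apply: (measurableT_comp (measurable_powR _)); exact: measurable_funM.
apply: measurable_fun_ifT => //; first exact: measurable_fun_ler.
  have mE : measurable_fun setT (fun z => expR (- (nu * z))).
    by apply: measurableT_comp => //; exact: measurableT_comp.
  rewrite /f_mid; do 2 (apply: measurable_funM => //).
  by apply: measurable_funM => //; exact: measurable_powR.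
apply: measurable_funM; first by apply: measurable_funM => //; exact: measurable_funM.
by apply: (measurableT_comp (measurable_powR _)); exact: measurable_funM.
Qed.

End robust_density.

(** * Contribution of an outlier relative to the density at the outlier *)

Section outlier_ratio.
Context (R : realType) (nu c : R).
Hypotheses (hnu : 1 < nu) (hc : 0 < c < sqrtr nu).

Lemma response_density (y eta : R) : 0 < y ->
  (expR eta)^-1 * f_rob nu c (y / expR eta) =
  y^-1 * (expR (ln y - eta) * f_rob nu c (expR (ln y - eta))).
Proof.
move=> y0; rewrite expRB lnK//; field.
by rewrite !gt_eqF ?expR_gt0.
Qed.

Let f_robE (y : R) : 0 < y ->
  f_rob nu c y = y^-1 * (expR (ln y) * f_rob nu c (expR (ln y))).
Proof. by move=> y0; rewrite lnK// mulKf// gt_eqF. Qed.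

(** Form taken by [data] at an index of the outlier set, detached from the index so that a single
    observation can be studied. *)
Definition outlier (large : bool) (k w : R) := if large then k * w else (k * w)^-1.

(** The likelihood factor of [y] at linear predictor [eta], normalised by the factor that (a)
    divides out. *)
Definition density_ratio (y eta : R) :=
  (expR eta)^-1 * f_rob nu c (y / expR eta) / f_rob nu c y.

Lemma outlier_gt0 large k w : 0 < k -> 0 < w -> 0 < outlier large k w.
Proof. by move=> k0 w0; rewrite /outlier; case: large; rewrite ?invr_gt0 mulr_gt0. Qed.

(** The factor [y^-1] does not depend on [eta], hence cancels. *)
Let density_ratioE y eta : 0 < y -> density_ratio y eta =
  (expR (ln y - eta) * f_rob nu c (expR (ln y - eta))) /
  (expR (ln y) * f_rob nu c (expR (ln y))).
Proof.
move=> y0; rewrite /density_ratio response_density// [in X in _ / X](f_robE y0).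
by rewrite -mulf_div divff ?mul1r// gt_eqF// invr_gt0.
Qed.

Lemma density_ratio_ge0 y eta : 0 <= density_ratio y eta.
Proof.
by rewrite /density_ratio divr_ge0 ?mulr_ge0 ?invr_ge0 ?expR_ge0 ?f_rob_ge0.
Qed.

Let ln_outlier_cvg (k : R) : 0 < k -> (ln (k * w) : R) @[w --> +oo] --> +oo.
Proof.
move=> k0; apply/cvgryPgt => A; near=> w.
have Akw : expR A < k * w.
  rewrite -ltr_pdivrMl//; near: w; exact: (nbhs_pinfty_gt (num_real _)).
by rewrite -(expRK A) ltr_ln// posrE ?expR_gt0// (lt_trans (expR_gt0 A)).
Unshelve. all: by end_near. Qed.

(* Seen from the side of the tail it lies in, an outlier [y] is [expR s] or
   [expR (- s)] with [s = ln (k * w)] going to +oo. *)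
Lemma density_ratio_tail large : exists h A U la,
  [/\ [/\ 0 < A, 0 < U, 0 <= la & forall u, U < u -> h u = A * (U / u) `^ la],
      (exists H, forall u, 0 <= h u <= H),
      (forall u, 0 < h u) &
      forall k w eta, 0 < k -> 0 < w ->
        density_ratio (outlier large k w) eta =
        h (ln (k * w) - (if large then eta else - eta)) / h (ln (k * w))].
Proof.
have [H hH] := f_rob_bounded hnu hc.
case: large.
- exists (fun u => expR u * f_rob nu c (expR u)).
  exists (f_mid nu (z_r nu c) * z_r nu c), (ln (z_r nu c)), (lambda_r nu c).
  split; last 1 first.
  - by move=> k w eta k0 w0; rewrite density_ratioE ?outlier_gt0.
  - split.
    + by rewrite mulr_gt0 ?f_mid_gt0 ?(lt_trans ltr01 (z_r_gt1 hc)).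
    + by rewrite ln_gt0 ?(z_r_gt1 hc).
    + exact: lambda_r_ge0.
    + by move=> u; exact: f_rob_right_tail.
  - by exists H.
  - by move=> u; rewrite mulr_gt0 ?expR_gt0 ?f_rob_gt0 ?expR_gt0.
- exists (fun u => expR (- u) * f_rob nu c (expR (- u))).
  exists (f_mid nu (z_l nu c) * z_l nu c), (ln (z_l nu c)^-1), (lambda_l nu c).
  split; last 1 first.
  (* For a small outlier [ln y - eta = - (s + eta)] with [s = ln (k * w)]: the reflection changes
     the sign of [eta]. *)
  - move=> k w eta k0 w0; have kw0 : 0 < k * w by exact: mulr_gt0.
    have lnE : ln (outlier false k w) = - ln (k * w) by exact: lnV.
    rewrite (density_ratioE _ (outlier_gt0 false k0 w0)) lnE.
    by rewrite opprB addrC.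
  - split.
    + by rewrite mulr_gt0 ?f_mid_gt0 ?(z_l_gt0 hc).
    + by rewrite ln_gt0// invf_gt1 ?(z_l_lt1 hc) ?(z_l_gt0 hc).
    + exact: lambda_l_ge0.
    + by move=> u; exact: f_rob_left_tail.
  - by exists H => u; exact: hH.
  - by move=> u; rewrite mulr_gt0 ?expR_gt0 ?f_rob_gt0 ?expR_gt0.
Qed.

Lemma density_ratio_cvg large k eta : 0 < k ->
  density_ratio (outlier large k w) eta @[w --> +oo] --> (1 : R).
Proof.
move=> k0; have [h [A [U [la [[A0 U0 la0 hE] _ _ hr]]]]] := density_ratio_tail large.
have : h (ln (k * w) - (if large then eta else - eta)) / h (ln (k * w))
    @[w --> +oo] --> (1 : R).
  apply: (@cvg_comp _ _ _ (fun w => ln (k * w))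
    (fun s => h (s - (if large then eta else - eta)) / h s) _ _ _
    (ln_outlier_cvg k0)).
  exact: tail_shift_cvg hE.
apply: cvg_trans; apply: near_eq_cvg; near=> w; apply/esym/hr => //.
Unshelve. all: by end_near. Qed.

(** The threshold on [w] is uniform in [eta], as domination requires. The power of [1 + |eta|] from
    [tail_shift_le] is traded for an exponential of arbitrarily small rate. *)
Lemma density_ratio_le large k eps : 0 < k -> 0 < eps ->
  exists2 C, 0 <= C & \forall w \near +oo, forall eta,
    density_ratio (outlier large k w) eta <= C * expR (eps * `|eta|).
Proof.
move=> k0 eps0.
have [h [A [U [la [[A0 U0 la0 hE] [H hH] hpos hr]]]]] := density_ratio_tail large.
have [C C0 hC] := tail_shift_le A0 U0 la0 hE hH.
have [D D0 hD] := powR_le_expR la0 eps0.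
exists (C * D); first by rewrite mulr_ge0// ltW.
near=> w => eta.
have w0 : 0 < w by near: w; exact: (nbhs_pinfty_gt (num_real _)).
have Uw : 2 * U < ln (k * w) by near: w; move/cvgryPgt : (ln_outlier_cvg k0); exact.
rewrite hr// ler_pdivrMr//; apply: (le_trans (hC _ _ Uw)).
rewrite ler_wpM2r ?(ltW (hpos _))// -mulrA ler_wpM2l//.
have -> : `|if large then eta else - eta| = `|eta| by case: large {hr}; rewrite ?normrN.
exact: hD.
Unshelve. all: by end_near. Qed.

End outlier_ratio.

(** * Prior, likelihood and posterior *)

Lemma sub_exponentialP d (T : measurableType d) (R : realType)
    (P : probability T R) (X : T -> R) : sub_exponential P X ->
  exists2 t, 0 < t & (\int[P]_w (expR (`|X w| / t))%:E < +oo)%E.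
Proof.
move=> /ereal_inf_lt[_ [t [t0 Et] _] _]; exists t => //.
by move: Et; rewrite unlock => /le_lt_trans; apply; rewrite ltry.
Qed.

Section prior.
Context (R : realType) (p : nat).
Variables (Prior : probability (p.-tuple R) R) (prior : p.-tuple R -> R).
Hypothesis hprior : has_density (lebesgue_tuple R p) Prior prior.

Local Notation mu := (lebesgue_tuple R p).

Let mprior : measurable_fun setT prior. Proof. by case: hprior. Qed.
Let prior_ge0 b : 0 <= prior b. Proof. by case: hprior. Qed.

Lemma integral_prior (f : p.-tuple R -> R) : measurable_fun setT f ->
  (\int[Prior]_b (f b)%:E = \int[mu]_b (f b * prior b)%:E)%E.
Proof.
move=> mf; rewrite -integral_density//.
apply: (@eq_measure_integral _ _ _ setT (density_measure mu mprior prior_ge0)).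
by move=> A mA _; case: hprior => _ _; apply.
Qed.

Lemma integral_prior1 : (\int[mu]_b (prior b)%:E = 1)%E.
Proof.
case: hprior => _ _ /(_ setT measurableT); rewrite probability_setT.
by move=> /esym.
Qed.

Lemma integrable_prior : mu.-integrable setT (EFin \o prior).
Proof.
apply/integrableP; split; first exact/measurable_EFinP.
under eq_integral do rewrite gee0_abs ?lee_fin//.
by rewrite integral_prior1 ltry.
Qed.

Lemma integrable_prior_bounded (f : p.-tuple R -> R) (M : R) :
    measurable_fun setT f -> (forall b, `|f b| <= M) ->
  mu.-integrable setT (fun b => (f b * prior b)%:E).
Proof.
move=> mf fM; apply: (@integrableMr _ _ _ mu _ _ f (EFin \o prior)) => //.
  exists M; split; first exact: num_real.
  by move=> x Mx b _; exact: le_trans (fM b) (ltW Mx).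
exact: integrable_prior.
Qed.

Lemma integral_prior_gt0 (f : p.-tuple R -> R) :
    measurable_fun setT f -> (forall b, 0 < f b) ->
  (0 < \int[mu]_b (prior b * f b)%:E)%E.
Proof.
by move=> mf f0; apply: integral_mul_gt0 => //; rewrite integral_prior1.
Qed.

(** Each coordinate comes with its own scale [t j]. Up to a constant, this sum times the prior is
    the dominating function used below. *)
Lemma integrable_prior_exp (hsubexp : forall j : 'I_p,
    sub_exponential Prior (fun b => tnth b j)) :
  exists2 t : 'I_p -> R, (forall j, 0 < t j) &
    mu.-integrable setT
      (fun b => ((\sum_(j < p) expR (`|tnth b j| / t j)) * prior b)%:E).
Proof.
have mexp (s : R) j : measurable_fun setT (fun b : p.-tuple R => expR (`|tnth b j| / s)).
  apply: measurableT_comp => //; apply: measurable_funM => //.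
  by apply: measurableT_comp => //; exact: measurable_tnth.
have tP j : exists t : R, 0 < t /\
    mu.-integrable setT (fun b => (expR (`|tnth b j| / t) * prior b)%:E).
  have [t t0 It] := sub_exponentialP (hsubexp j).
  exists t; split => //; apply/integrableP; split.
    by apply/measurable_EFinP; exact: measurable_funM.
  under eq_integral do rewrite gee0_abs ?lee_fin ?mulr_ge0 ?expR_ge0//.
  by rewrite -integral_prior.
have [t ht] := choice tP; exists t; first by move=> j; case: (ht j).
have -> : (fun b => ((\sum_(j < p) expR (`|tnth b j| / t j)) * prior b)%:E) =
    (fun b => \sum_(j < p) (expR (`|tnth b j| / t j) * prior b)%:E)%E.
  by apply/funext => b; rewrite sumEFin mulr_suml.
by apply: integrable_sum => // j; case: (ht j).
Qed.

End prior.

Lemma exp_linear_predictor_le (R : realType) (n p : nat) (hp : (0 < p)%N)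
    (x : 'I_n -> p.-tuple R) (t : 'I_p -> R) : (forall j, 0 < t j) ->
  exists2 eps, 0 < eps & forall (b : p.-tuple R) (I : {set 'I_n}),
    expR (\sum_(i in I) eps * `|\sum_(j < p) tnth (x i) j * tnth b j|) <=
    \sum_(j < p) expR (`|tnth b j| / t j).
Proof.
move=> t0.
pose X := \sum_(i < n) \sum_(j < p) `|tnth (x i) j|.
pose T := \sum_(j < p) t j.
have X0 : 0 <= X by rewrite sumr_ge0// => i _; rewrite sumr_ge0.
have tT j : t j <= T.
  by rewrite /T (bigD1 j)//= lerDl sumr_ge0// => k _; rewrite ltW.
have T0 : 0 < T := lt_le_trans (t0 (Ordinal hp)) (tT _).
(* The rate must not depend on [b], whereas the maximising index does; hence [T], which exceeds
   every [t j]. The [+ 1] covers a design with all entries zero. *)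
exists ((X + 1) * T)^-1; first by rewrite invr_gt0 mulr_gt0//; lra.
move=> b I; pose j0 := [arg max_(j > Ordinal hp) `|tnth b j|]%O.
have bj0 j : `|tnth b j| <= `|tnth b j0|.
  by rewrite /j0; case: Order.TotalTheory.arg_maxP => // k _; apply.
apply: (@le_trans _ _ (expR (`|tnth b j0| / t j0))); last first.
  by rewrite (bigD1 j0)//= lerDl sumr_ge0// => k _; exact: expR_ge0.
rewrite ler_expR -mulr_sumr.
(* Every coordinate is bounded by the largest one, and the sum over [I] of the coefficients by the
   sum over all indices. *)
have le1 : \sum_(i in I) `|\sum_(j < p) tnth (x i) j * tnth b j| <= X * `|tnth b j0|.
  rewrite /X mulr_suml [leRHS](bigID (mem I))/= -[leLHS]addr0 lerD//; last first.
    by rewrite sumr_ge0// => i _; rewrite mulr_ge0// sumr_ge0.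
  apply: ler_sum => i _; rewrite mulr_suml (le_trans (ler_norm_sum _ _ _))//.
  by apply: ler_sum => j _; rewrite normrM ler_wpM2l.
rewrite mulrC ler_pdivrMr; last by rewrite mulr_gt0//; lra.
apply: (le_trans le1).
rewrite mulrC -mulrA ler_wpM2l//.
rewrite mulrC -ler_pdivrMr ?invr_gt0// invrK.
rewrite (@le_trans _ _ ((X + 1) * t j0))//.
  by rewrite ler_wpM2r ?ltW//; lra.
by rewrite ler_wpM2l//; lra.
Qed.

Section likelihood.
Context (R : realType) (nu c : R).
Hypotheses (hnu : 1 < nu) (hc : 0 < c < sqrtr nu).
Context (n p : nat) (x : 'I_n -> p.-tuple R).
Implicit Types (I : {set 'I_n}) (y : 'I_n -> R).

Lemma measurable_mean_response i :
  measurable_fun setT (fun b : p.-tuple R => mean_response x b i).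
Proof.
apply: measurableT_comp => //; apply: measurable_sum => j.
by apply: measurable_funM => //; exact: measurable_tnth.
Qed.

Lemma measurable_likelihood I y :
  measurable_fun setT (fun b : p.-tuple R => likelihood nu c x I y b).
Proof.
rewrite /likelihood; under eq_fun do rewrite big_mkcond.
apply: measurable_prod => i _; case: (i \in I) => //.
have mV : measurable_fun setT (fun b : p.-tuple R => (mean_response x b i)^-1).
  by apply: (measurableT_comp (@measurable_invr R)); exact: measurable_mean_response.
apply: measurable_funM => //.
by apply: (measurableT_comp (@measurable_f_rob R nu c)); exact: measurable_funM.
Qed.

Lemma likelihood_gt0 I y b : (forall i, i \in I -> 0 < y i) ->
  0 < likelihood nu c x I y b.
Proof.
move=> y0; apply: prodr_gt0 => i /y0 yi.
by rewrite mulr_gt0 ?invr_gt0 ?expR_gt0// f_rob_gt0// divr_gt0 ?expR_gt0.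
Qed.

(** By [response_density] each factor is at most [(y i)^-1 * H], whatever the linear predictor. *)
Lemma likelihood_bounded I y : (forall i, i \in I -> 0 < y i) ->
  exists B, forall b : p.-tuple R, likelihood nu c x I y b <= B.
Proof.
move=> y0; have [H hH] := f_rob_bounded hnu hc.
exists (\prod_(i in I) ((y i)^-1 * H)) => b; apply: ler_prod => i iI.
rewrite /mean_response response_density ?y0//.
have /andP[h0 hi] := hH (ln (y i) - \sum_(j < p) tnth (x i) j * tnth b j).
rewrite mulr_ge0 ?invr_ge0 ?(ltW (y0 _ iI))//=.
by rewrite ler_wpM2l ?invr_ge0 ?(ltW (y0 _ iI)).
Qed.

Variables (Prior : probability (p.-tuple R) R) (prior : p.-tuple R -> R).
Hypothesis hprior : has_density (lebesgue_tuple R p) Prior prior.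

(** Positive because the prior has mass one and the likelihood is positive, finite because the
    likelihood is bounded. Hence [fine] loses nothing in the definition of the posterior. *)
Lemma marginal_gt0_fin I y : (forall i, i \in I -> 0 < y i) ->
  (0 < marginal nu c x prior I y < +oo)%E.
Proof.
move=> y0; have mL := measurable_likelihood I y.
have L0 b := likelihood_gt0 b y0.
rewrite /marginal; rewrite (integral_prior_gt0 hprior)//=.
have [B LB] := likelihood_bounded y0.
apply: integrable_lty => //.
under eq_fun do rewrite mulrC.
apply: (integrable_prior_bounded hprior (M := B)) => // b.
by rewrite ger0_norm// ltW.
Qed.

Lemma posterior_ge0 I y b : (forall i, i \in I -> 0 < y i) ->
  0 <= posterior nu c x prior I y b.
Proof.
move=> y0; have /andP[m0 _] := marginal_gt0_fin y0.
case: hprior => _ prior0 _.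
by rewrite divr_ge0 ?mulr_ge0 ?prior0 ?(ltW (likelihood_gt0 _ y0))// fine_ge0// ltW.
Qed.

Lemma measurable_posterior I y :
  measurable_fun setT (posterior nu c x prior I y).
Proof.
case: hprior => mprior _ _; apply: measurable_funM => //.
by apply: measurable_funM => //; exact: measurable_likelihood.
Qed.

Lemma integrable_prior_likelihood I y (g : p.-tuple R -> R) (M : R) :
    (forall i, i \in I -> 0 < y i) -> measurable_fun setT g ->
    (forall b, `|g b| <= M) ->
  (lebesgue_tuple R p).-integrable setT
    (fun b => (g b * (prior b * likelihood nu c x I y b))%:E).
Proof.
move=> y0 mg gM; have mL := measurable_likelihood I y.
have [B LB] := likelihood_bounded y0.
under eq_fun do rewrite mulrCA mulrC.
apply: (integrable_prior_bounded hprior (M := M * B)).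
  exact: measurable_funM.
by move=> b; rewrite normrM ler_pM// ger0_norm// ltW// likelihood_gt0.
Qed.

(** Writing a posterior expectation as a quotient of unnormalised integrals reduces (c) to the kind
    of limit needed for (a), which is the case [g = 1]. *)
Lemma integral_posterior I y (g : p.-tuple R -> R) (M : R) :
    (forall i, i \in I -> 0 < y i) -> measurable_fun setT g ->
    (forall b, `|g b| <= M) ->
  (\int[density_distribution (lebesgue_tuple R p) (posterior nu c x prior I y)]_b
    (g b)%:E = (fine (\int[lebesgue_tuple R p]_b
      (g b * (prior b * likelihood nu c x I y b))%:E) /
      fine (marginal nu c x prior I y))%:E)%E.
Proof.
move=> y0 mg gM; have ig := integrable_prior_likelihood y0 mg gM.
rewrite integral_density//; first last.
- by move=> b; exact: posterior_ge0.
- exact: measurable_posterior.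
rewrite EFinM fineK; last exact: integrable_fin_num.
rewrite -integralZr//.
by apply: eq_integral => b _; rewrite /posterior -EFinM mulrA.
Qed.

End likelihood.

(** * Outlier rejection *)

Section outlier_rejection.
Context (R : realType) (nu c : R).
Hypotheses (hnu : 1 < nu) (hc : 0 < c < sqrtr nu).
Context (n p : nat) (x : 'I_n -> p.-tuple R).
Variables (O : {set 'I_n}) (large : 'I_n -> bool) (a k : 'I_n -> R).
Hypotheses (ha : forall i, i \notin O -> 0 < a i).
Hypotheses (hk : forall i, i \in O -> 1 <= k i).
Variables (Prior : probability (p.-tuple R) R) (prior : p.-tuple R -> R).
Hypothesis hprior : has_density (lebesgue_tuple R p) Prior prior.

Local Notation mu := (lebesgue_tuple R p).
Local Notation y := (data O large a k).

Let k0 i : i \in O -> 0 < k i.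
Proof. by move=> iO; rewrite (lt_le_trans _ (hk iO)). Qed.

Lemma data_gt0 w i : 0 < w -> 0 < y w i.
Proof.
move=> w0; rewrite /data; case: ifPn => [iO|/ha//].
exact: outlier_gt0 (k0 iO) w0.
Qed.

(** For [w > 0] this is the full likelihood divided by the product of the densities at the outliers;
    here each outlier enters through a ratio tending to 1. *)
Definition rescaled_likelihood (w : R) (b : p.-tuple R) : R :=
  likelihood nu c x (~: O)%SET a b *
  \prod_(i in O) density_ratio nu c (y w i) (\sum_(j < p) tnth (x i) j * tnth b j).

Lemma prod_f_rob_gt0 w : 0 < w -> 0 < \prod_(i in O) f_rob nu c (y w i).
Proof. by move=> w0; apply: prodr_gt0 => i _; rewrite f_rob_gt0// data_gt0. Qed.

Lemma likelihood_dataE w b : 0 < w ->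
  likelihood nu c x [set: 'I_n]%SET (y w) b =
  rescaled_likelihood w b * \prod_(i in O) f_rob nu c (y w i).
Proof.
move=> w0; rewrite /rescaled_likelihood -mulrA -big_split/=.
rewrite [LHS](eq_bigl xpredT); last by move=> i; rewrite inE.
rewrite (bigID (mem O))/= mulrC; congr (_ * _).
  apply: eq_big => [i|i iO]; first by rewrite inE.
  by rewrite /data (negbTE iO).
apply: eq_bigr => i iO; rewrite /density_ratio divfK// gt_eqF// f_rob_gt0//.
exact: data_gt0.
Qed.

Lemma rescaled_likelihood_cvg b :
  rescaled_likelihood w b @[w --> +oo] --> likelihood nu c x (~: O)%SET a b.
Proof.
rewrite -[X in _ --> X]mulr1; apply: cvgM; first exact: cvg_cst.
(* The limit 1 is written as a product of ones over [O], to pass to the limit factor by factor. *)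
rewrite -[X in _ --> X](@big1_eq _ _ *%R 'I_n (index_enum 'I_n) (mem O)).
apply: cvg_big => [|i iO]; first exact: mul_continuous.
have -> : (fun w => density_ratio nu c (y w i) (\sum_(j < p) tnth (x i) j * tnth b j)) =
  fun w => density_ratio nu c (outlier (large i) (k i) w) (\sum_(j < p) tnth (x i) j * tnth b j).
  by apply/funext => w; rewrite /data (iO : i \in O).
exact: density_ratio_cvg (k0 iO).
Qed.

Lemma rescaled_likelihood_ge0 w b : 0 <= rescaled_likelihood w b.
Proof.
rewrite mulr_ge0 ?prodr_ge0// => i _; last exact: density_ratio_ge0.
by rewrite mulr_ge0 ?invr_ge0 ?expR_ge0 ?f_rob_ge0.
Qed.

Hypothesis hp : (0 < p)%N.
Hypothesis hsubexp : forall j : 'I_p, sub_exponential Prior (fun beta => tnth beta j).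

Lemma rescaled_likelihood_dominated : exists G : p.-tuple R -> R,
  mu.-integrable setT (fun b => (G b * prior b)%:E) /\
  \forall w \near +oo, forall b, rescaled_likelihood w b <= G b.
Proof.
have [t t0 it] := integrable_prior_exp hprior hsubexp.
have [eps eps0 hexp] := exp_linear_predictor_le hp x t0.
have [B LB] : exists B, forall b, likelihood nu c x (~: O)%SET a b <= B.
  by apply: likelihood_bounded => // i; rewrite inE => /ha.
(* Choice needs a constant at every index; outside [O] it is 0 and carries no bound. *)
have /choice[C hC] : forall i : 'I_n, exists C, 0 <= C /\ (i \in O ->
    \forall w \near +oo, forall eta,
    density_ratio nu c (outlier (large i) (k i) w) eta <= C * expR (eps * `|eta|)).
  move=> i; have [iO|_] := boolP (i \in O); last by exists 0.
  have [C C0 CP] := density_ratio_le hnu hc (large i) (k0 iO) eps0.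
  by exists C.
have C0 i : 0 <= C i by case: (hC i).
(* [B] bounds the factors of the non-outliers, the [C i] and the sum of exponentials those of the
   outliers. *)
exists (fun b => B * \prod_(i in O) C i * \sum_(j < p) expR (`|tnth b j| / t j)).
split.
  have -> : (fun b : p.-tuple R => (B * \prod_(i in O) C i *
      (\sum_(j < p) expR (`|tnth b j| / t j)) * prior b)%:E) =
    (fun b : p.-tuple R => (B * \prod_(i in O) C i)%:E *
      ((\sum_(j < p) expR (`|tnth b j| / t j)) * prior b)%:E)%E.
    by apply/funext => b; rewrite -EFinM mulrA.
  exact: integrableZl.
(* The indices being finitely many, one threshold on [w] serves all outliers. *)
have nearC : \forall w \near +oo, forall i, i \in O -> forall eta,
    density_ratio nu c (outlier (large i) (k i) w) eta <= C i * expR (eps * `|eta|).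
  apply: filter_forall => i; have [iO|iO] := boolP (i \in O); last by near=> w.
  by case: (hC i) => _ /(_ iO); apply: filterS => w + _; exact.
near=> w => b; rewrite -mulrA; apply: ler_pM => //.
- by rewrite prodr_ge0// => i _; rewrite mulr_ge0 ?invr_ge0 ?expR_ge0 ?f_rob_ge0.
- by rewrite prodr_ge0// => i _; exact: density_ratio_ge0.
apply: (@le_trans _ _ (\prod_(i in O) (C i *
    expR (eps * `|\sum_(j < p) tnth (x i) j * tnth b j|)))).
  apply: ler_prod => i iO; rewrite density_ratio_ge0//=.
  by rewrite /data iO; apply: (near nearC w) => //.
rewrite big_split/= ler_wpM2l ?prodr_ge0// -expR_sum.
exact: hexp.
Unshelve. all: by end_near. Qed.

Lemma integral_rescaled_cvg (g : p.-tuple R -> R) (M : R) :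
    measurable_fun setT g -> (forall b, `|g b| <= M) ->
  (\int[mu]_b (g b * (prior b * rescaled_likelihood w b))%:E)%E @[w --> +oo] -->
  (\int[mu]_b (g b * (prior b * likelihood nu c x (~: O)%SET a b))%:E)%E.
Proof.
move=> mg gM; have [mprior prior0 _] := hprior.
have [G [iG LG]] := rescaled_likelihood_dominated.
have M0 : 0 <= M := le_trans (normr_ge0 _) (gM [tuple 0 | _ < p]).
(* Measurability is required for every [w], but is derived from [likelihood_dataE], which assumes
   [w > 0]; the integrand is therefore set to 0 elsewhere, without effect on the limit. *)
pose f (w : R) b := if 0 < w then g b * (prior b * rescaled_likelihood w b) else 0.
have fE : \forall w \near +oo, (\int[mu]_b (f w b)%:E =
    \int[mu]_b (g b * (prior b * rescaled_likelihood w b))%:E)%E.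
  near=> w; have w0 : 0 < w by near: w; exact: (nbhs_pinfty_gt (num_real _)).
  by apply: eq_integral => b _; rewrite /f w0.
suff : (\int[mu]_b (f w b)%:E)%E @[w --> +oo] -->
    (\int[mu]_b (g b * (prior b * likelihood nu c x (~: O)%SET a b))%:E)%E.
  by apply: cvg_trans; exact: near_eq_cvg.
apply: (@dominated_convergence_pinfty _ _ _ mu f _
  (fun b => M * (G b * prior b))).
- move=> w; rewrite /f; case: ltP => // w0.
  apply: measurable_funM => //; apply: measurable_funM => //.
  have -> : rescaled_likelihood w = fun b =>
      likelihood nu c x [set: 'I_n]%SET (y w) b / \prod_(i in O) f_rob nu c (y w i).
    by apply/funext => b; rewrite likelihood_dataE// mulfK// gt_eqF// prod_f_rob_gt0.
  by apply: measurable_funM => //; exact: measurable_likelihood.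
- move=> b.
  have : g b * (prior b * rescaled_likelihood w b) @[w --> +oo] -->
      g b * (prior b * likelihood nu c x (~: O)%SET a b).
    apply: cvgM; first exact: cvg_cst.
    by apply: cvgM; [exact: cvg_cst|exact: rescaled_likelihood_cvg].
  apply: cvg_trans; apply: near_eq_cvg; near=> w.
  have w0 : 0 < w by near: w; exact: (nbhs_pinfty_gt (num_real _)).
  by rewrite /f w0.
- have -> : EFin \o (fun b => M * (G b * prior b)) =
      (fun b => M%:E * (G b * prior b)%:E)%E by apply/funext => b /=; rewrite EFinM.
  exact: integrableZl.
- near=> w => b; rewrite /f; case: ifPn => w0.
    have F0 := mulr_ge0 (prior0 b) (rescaled_likelihood_ge0 w b).
    rewrite normrM ler_pM// ger0_norm//.
    by rewrite mulrC ler_wpM2r//; apply: (near LG w).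
  rewrite normr0 mulr_ge0// mulr_ge0// (le_trans (rescaled_likelihood_ge0 w b))//.
  by apply: (near LG w).
Unshelve. all: by end_near. Qed.

Lemma integral_dataE (g : p.-tuple R -> R) (M w : R) : 0 < w ->
    measurable_fun setT g -> (forall b, `|g b| <= M) ->
  fine (\int[mu]_b (g b * (prior b * likelihood nu c x [set: 'I_n]%SET (y w) b))%:E) =
  fine (\int[mu]_b (g b * (prior b * rescaled_likelihood w b))%:E) *
  \prod_(i in O) f_rob nu c (y w i).
Proof.
move=> w0 mg gM.
have P0 := prod_f_rob_gt0 w0.
have y0 i : i \in [set: 'I_n]%SET -> 0 < y w i by move=> _; exact: data_gt0.
have lE b : rescaled_likelihood w b = likelihood nu c x [set: 'I_n]%SET (y w) b /
    \prod_(i in O) f_rob nu c (y w i).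
  by rewrite likelihood_dataE// mulfK// gt_eqF.
have ig := integrable_prior_likelihood hnu hc x hprior y0 mg gM.
have -> : (\int[mu]_b (g b * (prior b * rescaled_likelihood w b))%:E =
   \int[mu]_b (g b * (prior b * likelihood nu c x [set: 'I_n]%SET (y w) b))%:E *
   ((\prod_(i in O) f_rob nu c (y w i))^-1)%:E)%E.
  rewrite -integralZr//; apply: eq_integral => b _.
  by rewrite lE -EFinM !mulrA.
rewrite fineM//; last exact: integrable_fin_num.
by rewrite -mulrA mulVf ?mulr1// gt_eqF.
Qed.

End outlier_rejection.

Theorem theorem2 (R : realType) (nu c : R) (hnu : 1 < nu)
    (hc : 0 < c < sqrtr nu)
    (n p : nat) (hn : (0 < n)%N) (hp : (0 < p)%N)
    (x : 'I_n -> p.-tuple R)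
    (O : {set 'I_n}) (large : 'I_n -> bool) (a b : 'I_n -> R)
    (ha : forall i, i \notin O -> 0 < a i)
    (hb : forall i, i \in O -> 1 <= b i)
    (Prior : probability (p.-tuple R) R) (prior : p.-tuple R -> R)
    (hprior : has_density (lebesgue_tuple R p) Prior prior)
    (hindep : mutually_independent Prior (fun j beta => tnth beta j))
    (hsubexp : forall j : 'I_p,
       sub_exponential Prior (fun beta => tnth beta j)) :
  let y := data O large a b in
  let m (w : R) := marginal nu c x prior [set: 'I_n]%SET (y w) in
  let m_nonout := marginal nu c x prior (~: O)%SET a in
  let post (w : R) := posterior nu c x prior [set: 'I_n]%SET (y w) in
  let post_nonout := posterior nu c x prior (~: O)%SET a in
  (* the normalising constants are positive and finite *)
  ((forall w, 0 < w -> (0 < m w < +oo)%E) /\ (0 < m_nonout < +oo)%E) /\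
  (* (a) *)
  fine (m w) / \prod_(i in O) f_rob nu c (y w i) @[w --> +oo] -->
    fine m_nonout /\
  (* (b) *)
  (forall beta, post w beta @[w --> +oo] --> post_nonout beta) /\
  (* (c) *)
  cvg_in_distribution +oo
    (fun w => density_distribution (lebesgue_tuple R p) (post w))
    (density_distribution (lebesgue_tuple R p) post_nonout).
Proof.
move=> y m m_nonout post post_nonout.
have y0 w : 0 < w -> forall i, i \in [set: 'I_n]%SET -> 0 < y w i.
  by move=> w0 i _; exact: data_gt0.
have a0 i : i \in (~: O)%SET -> 0 < a i by rewrite inE => /ha.
have m0 w : 0 < w -> (0 < m w < +oo)%E.
  by move=> w0; apply: (marginal_gt0_fin hnu hc x hprior (y0 _ w0)).
have mn0 : (0 < m_nonout < +oo)%E.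
  exact: (marginal_gt0_fin hnu hc x hprior a0).
have near_gt0 : \forall w \near +oo, 0 < (w : R) by exact: (nbhs_pinfty_gt (num_real _)).
have P0 w : 0 < w -> 0 < \prod_(i in O) f_rob nu c (y w i).
  by move=> w0; exact: prod_f_rob_gt0.
(* The limit behind both (a) and (c): [g = 1] gives the marginals, a bounded continuous [g] the
   numerators of the posterior expectations. *)
have cvgI (g : p.-tuple R -> R) M : measurable_fun setT g -> (forall b, `|g b| <= M) ->
    fine (\int[lebesgue_tuple R p]_beta
      (g beta * (prior beta * likelihood nu c x [set: 'I_n]%SET (y w) beta))%:E) /
    \prod_(i in O) f_rob nu c (y w i) @[w --> +oo] -->
    fine (\int[lebesgue_tuple R p]_beta
      (g beta * (prior beta * likelihood nu c x (~: O)%SET a beta))%:E).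
  move=> mg gM.
  have := integral_rescaled_cvg hnu hc (x := x) large ha hb hprior hp hsubexp mg gM.
  rewrite -[X in _ --> X -> _]fineK; last first.
    exact/integrable_fin_num/(integrable_prior_likelihood hnu hc x hprior a0 mg gM).
  move=> /fine_cvg; apply: cvg_trans; apply: near_eq_cvg.
  apply: filterS near_gt0 => w w0.
  rewrite (integral_dataE hnu hc x large ha hb hprior w0 mg gM) mulfK//.
  by rewrite gt_eqF// P0.
have mE I z : marginal nu c x prior I z = (\int[lebesgue_tuple R p]_beta
    (1 * (prior beta * likelihood nu c x I z beta))%:E)%E.
  by apply: eq_integral => beta _; rewrite mul1r.
have cvgm : fine (m w) / \prod_(i in O) f_rob nu c (y w i) @[w --> +oo] -->
    fine m_nonout.
  rewrite /m_nonout mE /m; under eq_fun do rewrite mE.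
  by apply: (cvgI (cst 1) 1) => // b0; rewrite normr1.
have mn_neq0 : fine m_nonout != 0 by rewrite gt_eqF// fine_gt0.
do 3 split => //.
  move=> beta.
  (* For (b), numerator and normalising constant are both divided by the product of the outlier
     densities, after which each converges. *)
  have : prior beta * rescaled_likelihood nu c x O large a b w beta /
      (fine (m w) / \prod_(i in O) f_rob nu c (y w i)) @[w --> +oo] -->
      post_nonout beta.
    apply: cvgM; last exact: cvgV.
    by apply: cvgM; [exact: cvg_cst|exact: rescaled_likelihood_cvg].
  apply: cvg_trans; apply: near_eq_cvg; apply: filterS near_gt0 => w w0.
  rewrite /post /posterior likelihood_dataE//.
  by rewrite invfM invrK !mulrA mulrAC.
move=> g cg [M gM].
have mg := measurable_continuous_row cg.
have gM' (beta : p.-tuple R) : `|g (\row_j tnth beta j)| <= M by exact: gM.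
have postE := integral_posterior hnu hc x hprior a0 mg gM'.
have postE' w (w0 : 0 < w) := integral_posterior hnu hc x hprior (y0 w w0) mg gM'.
rewrite [X in _ --> X]postE.
apply: cvg_EFin.
  by apply: filterS near_gt0 => w w0; rewrite [X in X \is a fin_num](postE' _ w0).
(* For (c), the same product cancels in the quotient of the two limits. *)
apply: (cvg_trans _ (cvgM (cvgI _ _ mg gM') (cvgV mn_neq0 cvgm))).
apply: near_eq_cvg; apply: filterS near_gt0 => w w0.
rewrite [RHS](congr1 fine (postE' _ w0)) /=.
by rewrite invf_div mulrA divfK// gt_eqF// P0.
Qed.
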